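(* For $n\in\mathbb{N}$ let $P_n(x)=\frac{1}{n!}\frac{d^n}{dx^n}[x^n(1-x)^n]$ be the shifted Legendre polynomial and \[\mathfrak{J}_n=\int_{(0,1)^2}-P_n(x)P_n(y)\frac{\log(xy)}{1-xy}\,d(x,y).\] Then for every $n\in\mathbb{N}$, \[\mathfrak{J}_n\le 2\left(\frac{1}{24}\right)^n\zeta(3),\qquad \zeta(3)=\sum_{m=1}^{\infty}\frac{1}{m^3}.\]
   Context: $\log$ is the natural logarithm; the integral is the Lebesgue integral over the open unit square. *)

(* Defs.v *)
From HB Require Import structures.
From mathcomp Require Import all_boot all_order all_algebra.
From mathcomp Require Import all_classical all_reals all_analysis.

Set Implicit Arguments.
Unset Strict Implicit.
Unset Printing Implicit Defensive.

Import Order.TTheory GRing.Theory Num.Theory.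
Import numFieldNormedType.Exports.

Local Open Scope classical_set_scope.
Local Open Scope ring_scope.

(* [derive1n] is the iterated derivative of functions of a real variable. *)
Definition shifted_legendre (R : realType) (n : nat) (x : R) : R :=
  (n`!%:R)^-1 * derive1n n (fun t : R => t ^+ n * (1 - t) ^+ n) x.

Definition unit_square (R : realType) : set (R * R) :=
  `]0, 1[%classic `*` `]0, 1[%classic.

(* The integrand is integrable on the open square, so the real-valued integral
   is not a default value. *)
Definition frakJ (R : realType) (n : nat) : R :=
  (\int[((@lebesgue_measure R) \x (@lebesgue_measure R))%E]_(z in @unit_square R)
     (- shifted_legendre n z.1 * shifted_legendre n z.2
      * (ln (z.1 * z.2) / (1 - z.1 * z.2))))%R.

Definition zeta3 (R : realType) : R :=
  limn (fun n : nat => \sum_(1 <= m < n) ((m%:R : R) ^+ 3)^-1).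

(* Main.v *)
(* Expand 1/(1 - xy) in a geometric series and put
     q_n(t) = ((t-1)...(t-n)) / (t(t+1)...(t+n)).
   By partial fractions, int_0^1 P_n(x) x^(t-1) dx = (-1)^n q_n(t), and
   differentiating in t inserts a factor log x, so that
     J_n = - sum_(t = 1, 2, ...) (q_n^2)'(t).
   Zudilin's Zeilberger certificate for q_n(t)^2, differentiated in t, telescopes
   over t and yields Apery's recurrence
     (n+1)^3 J_(n+1) - (2n+1)(17n^2+17n+5) J_n + n^3 J_(n-1) = 0.
   Elementary bounds on q_n and q_n' give |J_n| <= 4(n+1).  If |J_n| exceeded
   |J_(n-1)|/24 for a single n, the recurrence would force growth by a factor 10
   at every later step; hence |J_n| <= |J_0|/24^n, and J_0 = 2 zeta(3). *)
Require Import Defs.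
From mathcomp Require Import all_boot all_order all_algebra.
From mathcomp Require Import all_classical all_reals all_analysis.
From mathcomp Require Import measurable_realfun ring lra.

Set Implicit Arguments.
Unset Strict Implicit.
Unset Printing Implicit Defensive.

Import Order.TTheory GRing.Theory Num.Theory.
Import numFieldNormedType.Exports.

Local Open Scope ring_scope.

(** * The rational function [legq] *)

Section RationalFunction.
Variable R : realFieldType.
Implicit Types (n j m : nat) (t : R).

Fixpoint legq n t : R :=
  if n is m.+1 then legq m t * ((t - n%:R) / (t + n%:R)) else t^-1.

(* The derivative of [legq n] in [t], kept formal so that everything below is
   rational function algebra. *)
Fixpoint dlegq n t : R :=
  if n is m.+1 then dlegq m t * ((t - n%:R) / (t + n%:R))
                    + legq m t * (2 * n%:R / (t + n%:R) ^+ 2)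
  else - (t ^+ 2)^-1.

Lemma legqS n t :
  legq n.+1 t = legq n t * ((t - n.+1%:R) / (t + n.+1%:R)).
Proof. by []. Qed.

Lemma dlegqS n t :
  dlegq n.+1 t = dlegq n t * ((t - n.+1%:R) / (t + n.+1%:R))
                 + legq n t * (2 * n.+1%:R / (t + n.+1%:R) ^+ 2).
Proof. by []. Qed.

(** The residue of [legq n] at t = -j and, up to the sign (-1)^n, the coefficient of x^j in the
    shifted Legendre polynomial. This double role links the integral to the series. *)
Definition legc n j : R := (-1) ^+ (n + j) * 'C(n, j)%:R * 'C(n + j, j)%:R.

Lemma natr_subSn_neq0 n j : (j <= n)%N -> n.+1%:R - j%:R != 0 :> R.
Proof. by move=> jn; rewrite -natrB ?leqW// pnatr_eq0 subn_eq0 -ltnNge ltnS. Qed.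

(** The factor is the value of (t - n - 1) / (t + n + 1) at t = -j: when [legq] gains this factor,
    the residue at an old pole is rescaled by it. *)
Lemma legc_succ n j : (j <= n)%N ->
  legc n.+1 j = legc n j * (- (n.+1%:R + j%:R) / (n.+1%:R - j%:R)).
Proof.
move=> jn; rewrite /legc addSn exprS.
have d0 := natr_subSn_neq0 jn.
have n0 : n.+1%:R != 0 :> R by rewrite pnatr_eq0.
have e1 : 'C(n.+1, j)%:R = 'C(n, j)%:R * n.+1%:R / (n.+1%:R - j%:R) :> R.
  apply: (canRL (mulfK d0)); rewrite -natrB ?leqW// -!natrM mulnC.
  by rewrite -mul_bin_down mulnC.
have e2 : 'C((n + j).+1, j)%:R = 'C(n + j, j)%:R * (n.+1%:R + j%:R) / n.+1%:R :> R.
  apply: (canRL (mulfK n0)); rewrite -natrD -!natrM; congr (_%:R).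
  by have := mul_bin_down (n + j).+1 j; rewrite -addSn addnK [LHS]mulnC => ->; rewrite mulnC.
rewrite e1 e2; move: (n.+1%:R) (j%:R) n0 d0 => a b a0 ab0.
by field; rewrite a0 ab0.
Qed.

(* The value at the next pole, which gives the residue of the partial fraction
   entering at step [n.+1]. *)
Lemma legq_pole n m : (m <= n)%N ->
  legq m (- n.+1%:R) = - ((n + m).+1`!%:R * (n - m)`!%:R / n.+1`!%:R ^+ 2).
Proof.
have f0 k : k`!%:R != 0 :> R by rewrite pnatr_eq0 -lt0n fact_gt0.
have s0 k : k.+1%:R != 0 :> R by rewrite pnatr_eq0.
elim: m => [_|m IH mn] /=.
  rewrite addn0 subn0 factS natrM invrN; congr (- _).
  move: (f0 n) (s0 n); move: (n.+1%:R) (n`!%:R) => a b b0 a0.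
  by field; rewrite a0 b0.
rewrite IH ?(ltnW mn)// addnS (factS (n + m).+1) natrM.
rewrite -(subnSK mn) (factS (n - m.+1)) natrM.
have e : (n - m.+1).+1%:R = n.+1%:R - m.+1%:R :> R by rewrite subnSK// -subSS natrB// ltnS ltnW.
have -> : (n + m).+2%:R = n.+1%:R + m.+1%:R :> R by rewrite -natrD addSn addnS.
rewrite e.
have d0 : n.+1%:R - m.+1%:R != 0 :> R by rewrite natr_subSn_neq0.
move: (f0 n.+1) d0; move: (n.+1%:R) (m.+1%:R) (n.+1`!%:R) => a b c c0 d0.
by field; rewrite c0 -oppr_eq0 opprD opprK.
Qed.

(** Induction on n: the new factor rescales the old residues by [legc_succ] and adds a simple pole
    at -(n + 1). The formal derivative follows the same decomposition, so both formulas are carried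
    together. *)
Lemma legq_partial_fractions n t : (forall j, (j <= n)%N -> t + j%:R != 0) ->
  legq n t = \sum_(j < n.+1) legc n j / (t + j%:R) /\
  dlegq n t = - \sum_(j < n.+1) legc n j / (t + j%:R) ^+ 2.
Proof.
elim: n t => [|n IH] t ht.
  rewrite !big_ord_recl !big_ord0/= /legc bin0 /=.
  by have := ht 0%N isT; rewrite addr0 => t0; split; field.
have [IH1 IH2] := IH t (fun j jn => ht j (leqW jn)).
have tn0 := ht n.+1 (leqnn _).
(* Residue at the new pole: each old fraction contributes 2(n+1) / (n+1-j), and the total is -2(n+1)
   times the value of [legq n] at -(n+1), known from [legq_pole]. *)
have last : legc n.+1 n.+1 =
    \sum_(j < n.+1) legc n j * (2 * n.+1%:R / (n.+1%:R - j%:R)).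
  have := legq_pole (leqnn n).
  rewrite (IH _ _).1 => [|j jn]; last first.
    by rewrite addrC -opprB oppr_eq0 natr_subSn_neq0.
  move=> e.
  transitivity (- (2 * n.+1%:R)
      * (\sum_(j < n.+1) legc n j / (- n.+1%:R + j%:R))); last first.
    rewrite mulr_sumr; apply: eq_bigr => j _.
    have d0 := natr_subSn_neq0 (ltn_ord j : j <= n)%N.
    have -> : - n.+1%:R + j%:R = - (n.+1%:R - j%:R) :> R by rewrite opprB addrC.
    rewrite invrN; move: (n.+1%:R) (j%:R) d0 => a b d0.
    by field.
  have h : 'C(n.+1 + n.+1, n.+1)%:R * n.+1`!%:R ^+ 2
      = (n + n).+1`!%:R * (2 * n.+1%:R) :> R.
    have := bin_fact (leq_addl n.+1 n.+1); rewrite addnK => h.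
    rewrite expr2 -!natrM h addnS addSn (factS (n + n).+1).
    by rewrite mulnC mul2n -addnn addSn addnS.
  rewrite e subnn fact0 /legc binn -signr_odd oddD addbb expr0 !mul1r.
  have f0 : n.+1`!%:R != 0 :> R by rewrite pnatr_eq0 -lt0n fact_gt0.
  apply: (mulIf (expf_neq0 2 f0)); rewrite h.
  move: (n.+1%:R) (n.+1`!%:R) ((n + n).+1`!%:R) f0 => a b c b0.
  by field.
have rest (j : 'I_n.+1) := legc_succ (ltn_ord j : j <= n)%N.
rewrite /= IH1 IH2 !(big_ord_recr n.+1)/= last !mulr_suml.
split.
  rewrite -big_split/=; apply: eq_bigr => j _; rewrite rest.
  have d0 := natr_subSn_neq0 (ltn_ord j : j <= n)%N.
  have tj := ht j (ltnW (ltn_ord j)).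
  move: (n.+1%:R) (j%:R) d0 tj tn0 => a b d0 tj tn0.
  by field; rewrite tj tn0 d0.
rewrite mulNr mulr_suml -sumrN -!big_split/= -sumrN.
apply: eq_bigr => j _; rewrite rest.
have d0 := natr_subSn_neq0 (ltn_ord j : j <= n)%N.
have tj := ht j (ltnW (ltn_ord j)).
move: (n.+1%:R) (j%:R) d0 tj tn0 => a b d0 tj tn0.
  by field; rewrite tj tn0 d0.
Qed.

(** The shift turns the numerator into t(t-1)...(t-n) and the denominator into (t+1)...(t+n+2), so
    only a rational factor separates it from [legq n t]; the second formula is the product rule. *)
Lemma legq_shift n t : 0 < t ->
  legq n.+1 (t + 1) = legq n t * (t ^+ 2 / ((t + n.+1%:R) * (t + n.+2%:R))) /\
  dlegq n.+1 (t + 1) = dlegq n t * (t ^+ 2 / ((t + n.+1%:R) * (t + n.+2%:R)))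
    + legq n t * (2 * t / ((t + n.+1%:R) * (t + n.+2%:R))
        - t ^+ 2 * (2 * t + n.+1%:R + n.+2%:R)
          / ((t + n.+1%:R) * (t + n.+2%:R)) ^+ 2).
Proof.
move=> t0.
have p k : t + k%:R != 0 by rewrite gt_eqF// ltr_wpDr.
elim: n => [|n [IH1 IH2]].
  have := p 2%N; have := p 1%N; have := p 0%N; rewrite addr0 => p0 p1 p2.
  split => /=.
    by field; rewrite p2 p1 p0.
  by field; rewrite p2 p1 p0.
rewrite (legqS n.+1 (t + 1)) (dlegqS n.+1 (t + 1)) IH1 IH2.
rewrite (legqS n t) (dlegqS n t).
have := p n.+3; have := p n.+2; have := p n.+1.
have -> : n.+3%:R = n.+1%:R + 2 :> R by rewrite -natrD addn2.
have -> : n.+2%:R = n.+1%:R + 1 :> R by rewrite natr1.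
move: (n.+1%:R) => a p1 p2 p3.
by split; field; rewrite p1 p2 p3.
Qed.

(* The derivative in [t] of Zudilin's certificate
   4 (2n+1) (-2t^2 + t + (2n+1)^2) q_n(t)^2. *)
Definition dlegS n t : R := 4 * (2 * n%:R + 1)
  * ((1 - 4 * t) * legq n t ^+ 2
     + (t - 2 * t ^+ 2 + (2 * n%:R + 1) ^+ 2) * (2 * legq n t * dlegq n t)).

(** Every term reduces to a rational multiple of [legq n t] times itself or [dlegq n t], leaving an
    identity for [field]. With a = n + 1 the middle coefficient is (2a+1)(17a^2+17a+5). *)
Lemma dlegq_recurrence n t : 0 < t ->
  n.+2%:R ^+ 3 * (2 * legq n.+2 t * dlegq n.+2 t)
  - (34 * n.+1%:R ^+ 3 + 51 * n.+1%:R ^+ 2 + 27 * n.+1%:R + 5)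
    * (2 * legq n.+1 t * dlegq n.+1 t)
  + n.+1%:R ^+ 3 * (2 * legq n t * dlegq n t)
  = dlegS n.+1 (t + 1) - dlegS n.+1 t.
Proof.
move=> t0; rewrite /dlegS (legq_shift n t0).1 (legq_shift n t0).2.
rewrite !(legqS n.+1) !(dlegqS n.+1) !(legqS n) !(dlegqS n).
have p k : t + k%:R != 0 by rewrite gt_eqF// ltr_wpDr.
have := p n.+2; have := p n.+1.
have -> : n.+2%:R = n.+1%:R + 1 :> R by rewrite natr1.
move: (legq n t) (dlegq n t) (n.+1%:R) => q d a p1 p2.
by field; rewrite p1 p2.
Qed.

(** * Zeros and size bounds *)

Lemma legq_nat_eq0 n k : (0 < k <= n)%N -> legq n k%:R = 0.
Proof.
elim: n => [|n IH]; first by case: k.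
move=> /andP[k0]; rewrite leq_eqVlt => /predU1P[->|kn]; rewrite legqS.
  by rewrite subrr mul0r mulr0.
by rewrite IH ?k0// mul0r.
Qed.

Lemma legq_le n t : 0 < t -> `|legq n t| <= t^-1.
Proof.
move=> t0; elim: n => [|n IH]; first by rewrite /= ger0_norm// invr_ge0 ltW.
rewrite legqS normrM -[leRHS]mulr1 ler_pM//.
have tn : 0 < t + n.+1%:R by rewrite ltr_wpDr.
rewrite normrM [`|_^-1|]gtr0_norm ?invr_gt0// ler_pdivrMr// mul1r ler_norml.
by have : 0 <= n.+1%:R :> R by []; move: (n.+1%:R) => a a0; apply/andP; split; lra.
Qed.

(** Each of the n + 1 product rule terms is at most 1/t^2, because 2kt <= (t+k)^2. *)
Lemma dlegq_le n t : 0 < t -> `|dlegq n t| <= n.+1%:R / t ^+ 2.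
Proof.
move=> t0; elim: n => [|n IH].
  by rewrite /= normrN div1r ger0_norm// invr_ge0 exprn_ge0// ltW.
have tn : 0 < t + n.+1%:R by rewrite ltr_wpDr.
have t2 : 0 < t ^+ 2 by rewrite exprn_gt0.
rewrite dlegqS (le_trans (ler_normD _ _))// -[n.+2%:R]natr1 [leRHS]mulrDl lerD//.
  rewrite normrM -[leRHS]mulr1 ler_pM//.
  rewrite normrM [`|_^-1|]gtr0_norm ?invr_gt0// ler_pdivrMr// mul1r ler_norml.
  by have : 0 <= n.+1%:R :> R by []; move: (n.+1%:R) => a a0; apply/andP; split; lra.
have -> : 1 / t ^+ 2 = t^-1 * t^-1 by rewrite mul1r expr2 invfM.
rewrite normrM ler_pM ?legq_le//.
rewrite ger0_norm; last by rewrite divr_ge0 ?exprn_ge0// ?mulr_ge0// ltW.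
rewrite ler_pdivrMr ?exprn_gt0// ler_pdivlMl//.
have : 0 <= n.+1%:R :> R by []; move: (n.+1%:R) => a a0.
by rewrite expr2; nra.
Qed.

Lemma legq_dlegq_le n t : 0 < t ->
  `|2 * legq n t * dlegq n t| <= 2 * n.+1%:R * (t ^+ 3)^-1.
Proof.
move=> t0; rewrite normrM normrM ger0_norm// -!mulrA ler_pM2l//.
have -> : n.+1%:R * t ^- 3 = t^-1 * (n.+1%:R / t ^+ 2).
  by rewrite exprS invfM mulrCA.
by rewrite ler_pM ?legq_le ?dlegq_le.
Qed.

(** Only the decay like 1/t matters. The constants are crude: 5 comes from |1 - 4t| <= 5t and 3 from
    |t - 2t^2| <= 3t^2. *)
Lemma dlegS_le n t : 1 <= t ->
  `|dlegS n t| <= 4 * (2 * n%:R + 1)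
    * (5 + (3 + (2 * n%:R + 1) ^+ 2) * (2 * n.+1%:R)) / t.
Proof.
move=> t1; have t0 : 0 < t by rewrite (lt_le_trans ltr01).
have n0 : 0 <= n%:R :> R by [].
rewrite /dlegS normrM -[in leRHS]mulrA ger0_norm; last by lra.
rewrite ler_wpM2l ?mulr_ge0 ?addr_ge0 ?mulr_ge0//.
rewrite (le_trans (ler_normD _ _))// [leRHS]mulrDl lerD//.
  rewrite normrM normrX.
  have -> : 5 / t = 5 * t * (t^-1) ^+ 2 by field; rewrite gt_eqF.
  rewrite ler_pM ?exprn_ge0//; first by rewrite ler_norml; apply/andP; split; lra.
  by rewrite lerXn2r ?nnegrE ?invr_ge0 ?legq_le// ltW.
rewrite normrM.
have -> : (3 + (2 * n%:R + 1) ^+ 2) * (2 * n.+1%:R) / t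
  = (3 + (2 * n%:R + 1) ^+ 2) * t ^+ 2 * (2 * n.+1%:R * (t ^+ 3)^-1).
  by move: (n.+1%:R) (n%:R) => a b; field; rewrite gt_eqF.
rewrite ler_pM ?legq_dlegq_le//.
have : 0 <= (2 * n%:R + 1) ^+ 2 :> R by rewrite exprn_ge0//; lra.
move: ((2 * n%:R + 1) ^+ 2) => b b0.
have tt : t <= t ^+ 2 by rewrite expr2 -[leLHS]mulr1 ler_wpM2l// ltW.
have bt : b <= b * t ^+ 2 by rewrite ler_peMr// (le_trans t1).
rewrite [leRHS]mulrDl; move: (t ^+ 2) (b * t ^+ 2) tt bt => t2 bt2 tt bt.
by rewrite ler_norml; apply/andP; split; lra.
Qed.

Lemma sum_inv_cube_le K : \sum_(1 <= k < K) ((k%:R : R) ^+ 3)^-1 <= 2.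
Proof.
(* The correction 2/(K+1) makes the induction close: 1/a^3 <= 2/a - 2/(a+1) for a >= 1. *)
suff h : \sum_(1 <= k < K.+1) ((k%:R : R) ^+ 3)^-1 <= 2 - 2 / K.+1%:R.
  case: K h => [|K] h; first by rewrite big_geq.
  have : \sum_(1 <= k < K.+1) ((k%:R : R) ^+ 3)^-1 <= 2 - 2 / K.+2%:R.
    by apply: le_trans h; rewrite [leRHS]big_nat_recr//= lerDl invr_ge0 exprn_ge0.
  by move=> /le_trans; apply; rewrite gerBl divr_ge0.
elim: K => [|K IH]; first by rewrite big_geq// divr1 subrr.
rewrite big_nat_recr//= (le_trans (lerD IH (lexx _)))//.
have -> : K.+2%:R = K.+1%:R + 1 :> R by rewrite natr1.
have : 1 <= K.+1%:R :> R by rewrite ler1n.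
move: (K.+1%:R) => a a1.
have a0 : 0 < a by lra.
rewrite -subr_ge0.
have -> : 2 - 2 / (a + 1) - (2 - 2 / a + (a ^+ 3)^-1)
   = (2 * a ^+ 2 - a - 1) / ((a + 1) * a ^+ 3).
  by field; rewrite !gt_eqF//; lra.
rewrite divr_ge0 ?mulr_ge0 ?exprn_ge0//; [|lra..].
by rewrite expr2; nra.
Qed.

End RationalFunction.

Local Open Scope classical_set_scope.

(** * The recurrence and the decay of its bounded solutions *)

Section Decay.
Variable R : realType.
Implicit Types (n k K : nat).

(** Minus the derivative of the square of [legq n] at t = k + 1; the shift lets the series over t >=
    1 start at index 0. *)
Definition legterm n k : R := - (2 * legq n k.+1%:R * dlegq n k.+1%:R).

Lemma dlegS_cvg0 n : dlegS n (K.+1%:R : R) @[K --> \oo] --> (0 : R).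
Proof.
set C : R := 4 * (2 * n%:R + 1) * (5 + (3 + (2 * n%:R + 1) ^+ 2) * (2 * n.+1%:R)).
have hC : (fun K => C * harmonic K) @ \oo --> (0 : R).
  rewrite -[X in _ --> X](mulr0 C); apply: cvgM; first exact: cvg_cst.
  exact: cvg_harmonic.
have hNC : (fun K => - (C * harmonic K)) @ \oo --> (0 : R).
  by rewrite -[X in _ --> X]oppr0; apply: cvgN.
apply: (squeeze_cvgr _ hNC hC); near=> K.
by rewrite -ler_norml; apply: dlegS_le; rewrite ler1n.
Unshelve. all: by end_near. Qed.

(** The decay argument sees only the series; [J] becomes [frakJ R] once [frakJ_cvg] is available. *)
Variable J : nat -> R.
Hypothesis J_cvg : forall n, \sum_(0 <= k < K) legterm n k @[K --> \oo] --> J n.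

(** The same combination of partial sums telescopes to minus the certificate at K + 1, which
    vanishes in the limit by [dlegS_cvg0]. *)
Lemma apery_recurrence n :
  n.+2%:R ^+ 3 * J n.+2
  - (34 * n.+1%:R ^+ 3 + 51 * n.+1%:R ^+ 2 + 27 * n.+1%:R + 5) * J n.+1
  + n.+1%:R ^+ 3 * J n = 0.
Proof.
set a : R := n.+2%:R ^+ 3; set c : R := n.+1%:R ^+ 3; set b : R := _ + 5.
pose u K := a * \sum_(0 <= k < K) legterm n.+2 k
    - b * \sum_(0 <= k < K) legterm n.+1 k
    + c * \sum_(0 <= k < K) legterm n k.
have h1 : u K @[K --> \oo] --> a * J n.+2 - b * J n.+1 + c * J n.
  by apply: cvgD; [apply: cvgB|]; apply: cvgM => //; exact: cvg_cst.
suff h0 : u K @[K --> \oo] --> (0 : R) by exact: cvg_unique h1 h0.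
rewrite -[X in _ --> X]oppr0.
suff -> : u = (fun K => - dlegS n.+1 K.+1%:R) by exact: (cvgN (dlegS_cvg0 n.+1)).
apply/funext => K; rewrite /u.
transitivity (- \sum_(0 <= k < K) (dlegS n.+1 (k.+2%:R : R) - dlegS n.+1 k.+1%:R)); last first.
  (* No lower boundary term remains: t = 1 is a zero of [legq n.+1], a factor of both summands of
     [dlegS]. *)
  have S1 : dlegS n.+1 1%:R = 0 :> R.
    by rewrite /dlegS (@legq_nat_eq0 R n.+1 1)//; ring.
  by rewrite (telescope_sumr (fun k => dlegS n.+1 (k.+1%:R : R)))// S1 subr0.
rewrite !mulr_sumr -sumrN -sumrN -!big_split/=; apply: eq_bigr => k _.
have := @dlegq_recurrence R n k.+1%:R; rewrite natr1 ltr0Sn => /(_ isT) <-.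
by rewrite /legterm -/a -/b -/c; ring.
Qed.

Lemma apery_bound n : `|J n| <= 4 * n.+1%:R.
Proof.
apply: (cvgr_to_le (cvg_norm (@J_cvg n))); apply: nearW => K.
rewrite (le_trans (ler_norm_sum _ _ _))//.
rewrite (@le_trans _ _ (\sum_(0 <= k < K) 2 * n.+1%:R * (k.+1%:R ^+ 3)^-1))//.
  by apply: ler_sum => k _; rewrite normrN legq_dlegq_le.
rewrite -mulr_sumr (_ : 4 = 2 * 2 :> R); last by rewrite -natrM.
rewrite [leRHS]mulrAC ler_wpM2l// ?mulr_ge0//.
by have := sum_inv_cube_le R K.+1; rewrite big_add1.
Qed.

(* If [J] ever failed to drop by the factor 24, the recurrence would force it to
   grow by a factor 10 at each later step, contradicting the linear bound. *)
Lemma apery_decay n : `|J n.+1| <= `|J n| / 24.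
Proof.
rewrite leNgt; apply/negP => Jn.
have step m : `|J m| < 24 * `|J m.+1| -> 10 * `|J m.+1| <= `|J m.+2|.
  move=> Jm; have := apery_recurrence m.
  set a : R := m.+1%:R; have a1 : 1 <= a by rewrite ler1n.
  have -> : m.+2%:R = a + 1 by rewrite natr1.
  set b : R := _ + 5; set x := J m.+2; set y := J m.+1; set z := J m => e.
  have e' : b * y = (a + 1) ^+ 3 * x + a ^+ 3 * z.
    by apply/eqP; rewrite -subr_eq0 -oppr_eq0; apply/eqP; rewrite -[RHS]e; ring.
  have b0 : 0 <= b by rewrite /b !addr_ge0 ?mulr_ge0 ?exprn_ge0//; lra.
  have a30 : 0 < a ^+ 3 by rewrite exprn_gt0//; lra.
  have a130 : 0 < (a + 1) ^+ 3 by rewrite exprn_gt0//; lra.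
  have h : b * `|y| <= (a + 1) ^+ 3 * `|x| + a ^+ 3 * (24 * `|y|).
    rewrite -[b in leLHS]ger0_norm// -normrM e' (le_trans (ler_normD _ _))//.
    by rewrite (normrM (a ^+ 3)) (normrM ((a + 1) ^+ 3))
      (gtr0_norm a30) (gtr0_norm a130) lerD2l ler_pM2l// ltW.
  (* The growth rate 10 is the leading coefficient 34 minus the 24 lost to the term in [z]; the
     remainder 21a^2 - 3a - 5 is positive for a >= 1. *)
  have hb : 10 * (a + 1) ^+ 3 + 24 * a ^+ 3 <= b.
    rewrite /b -subr_ge0.
    have -> : 34 * a ^+ 3 + 51 * a ^+ 2 + 27 * a + 5
      - (10 * (a + 1) ^+ 3 + 24 * a ^+ 3) = 21 * a ^+ 2 - 3 * a - 5 by ring.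
    by rewrite expr2; nra.
  rewrite -(ler_pM2l a130).
  have := ler_wpM2r (normr_ge0 y) hb.
  by move: h; move: (`|x|) (`|y|) ((a + 1) ^+ 3) (a ^+ 3) => X Y A B; lra.
(* Growth by 10 renews the hypothesis of [step] at the next index, so it can be iterated. *)
have grow m : `|J (n + m)%N| < 24 * `|J (n + m).+1| /\ 10 ^+ m * `|J n.+1| <= `|J (n + m).+1|.
  elim: m => [|m [IH1 IH2]].
    by rewrite addn0 expr0 mul1r; split => //; lra.
  have := step _ IH1; rewrite addnS => s; split.
    by have := normr_ge0 (J (n + m)%N); lra.
  by rewrite exprS -mulrA (le_trans _ s)// ler_pM2l.
have Jn0 : 0 < `|J n.+1| by rewrite (le_lt_trans _ Jn)// divr_ge0.
(* Weakening 10^m to (m+1)^2 and cancelling one m + 1 against the linear bound leaves a quantity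
   linear in m below a constant, which the Archimedean property refutes. *)
have lin m : m.+1%:R * `|J n.+1| <= 4 * n.+2%:R.
  have h1 : m.+1%:R ^+ 2 <= 10 ^+ m :> R.
    rewrite (@le_trans _ _ (4 ^+ m))// ?lerXn2r ?nnegrE//; last by lra.
    have -> : 4 = 2 ^+ 2 :> R by rewrite -natrX.
    by rewrite -exprM mulnC exprM lerXn2r ?nnegrE// -natrX ler_nat ltn_expl.
  have h2 := le_trans (grow m).2 (apery_bound (n + m).+1).
  have h3 : m.+1%:R ^+ 2 * `|J n.+1| <= 4 * (n.+2%:R * m.+1%:R).
    rewrite (le_trans (ler_wpM2r (normr_ge0 _) h1))// (le_trans h2)//.
    rewrite ler_pM2l// -natrM ler_nat.
    rewrite (_ : (n + m).+2 = m.+1 + n.+1)%N; last by rewrite addSn addnS addnC.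
    by rewrite mulSn leq_add2l leq_pmulr.
  by rewrite -(@ler_pM2l _ m.+1%:R) ?ltr0Sn// mulrA -expr2 mulrCA [_ * n.+2%:R]mulrC.
have := archi_boundP (_ : 0 <= 4 * n.+2%:R / `|J n.+1|).
rewrite divr_ge0// => /(_ isT); set N := Num.bound _ => hN.
have := lin N; rewrite leNgt => /negP; apply.
rewrite -ltr_pdivrMr// (lt_le_trans hN)// ler_nat//.
Qed.

Lemma apery_geometric n : `|J n| <= `|J 0%N| / 24 ^+ n.
Proof.
elim: n => [|n IH]; first by rewrite expr0 divr1.
rewrite (le_trans (apery_decay n))// exprSr invfM mulrA ler_wpM2r//.
Qed.

End Decay.

(** * Integrals over the unit interval *)

Section UnitInterval.
Variable R : realType.
Notation mu := (@lebesgue_measure R).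

(** The fundamental theorem on [exp(-k), 1] and monotone convergence in k, so [F] needs only a limit
    along exp(-k), not a value at 0. These endpoints give [ln] the value -k. *)
Lemma integral_unit_itv (f F : R -> R) (l : R) :
  (forall x : R, 0 < x -> is_derive x 1 F (f x)) ->
  (forall x : R, 0 < x -> {for x, continuous f}) ->
  (forall x : R, 0 < x <= 1 -> 0 <= f x) ->
  F (expR (- k%:R)) @[k --> \oo] --> l ->
  (\int[mu]_(x in `]0%R, 1%R[) (f x)%:E = (F 1 - l)%:E)%E.
Proof.
move=> dF cf f0 Fl.
have mf : measurable_fun (`]0, 1]%classic : set R) f.
  apply: subspace_continuous_measurable_fun => //.
  apply: continuous_in_subspaceT => x /[!inE]/=; rewrite in_itv/= => /andP[x0 _].
  exact: cf.
rewrite integral_itv_bndo_bndc; last first.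
  apply/measurable_EFinP; apply: measurable_funS mf => //.
  by apply: subset_itvl; rewrite bnd_simp.
pose E k : set R := `[expR (- k%:R), 1]%classic.
have Eunion : \bigcup_k E k = `]0, 1]%classic.
  apply/seteqP; split => x /=.
    move=> [k _]; rewrite /E/= !in_itv/= => /andP[+ ->]; rewrite andbT.
    by apply: lt_le_trans; exact: expR_gt0.
  rewrite in_itv/= => /andP[x0 x1].
  exists (Num.bound (- ln x)) => //=; rewrite /E/= in_itv/= x1 andbT.
  rewrite -[leRHS]lnK ?posrE// ler_expR lerNl ltW// archi_boundP//.
  by rewrite oppr_ge0 ln_le0.
have EI k : E k `<=` `]0, 1]%classic.
  by rewrite -Eunion; exact: bigcup_sup.
have intE k : (\int[mu]_(x in E k) (f x)%:E = (F 1 - F (expR (- k%:R)))%:E)%E.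
  (* For k = 0 the interval is the single point 1, while the fundamental theorem wants distinct
     endpoints. *)
  case: k => [|k].
    by rewrite /E oppr0 expR0 set_itv1 integral_set1 subrr.
  have e1 : expR (- k.+1%:R) < 1 :> R by rewrite -expR0 ltr_expR oppr_lt0.
  have e0 : 0 < expR (- k.+1%:R) :> R by exact: expR_gt0.
  have cF x : 0 < x -> {for x, continuous F}.
    by move=> x0; apply/differentiable_continuous/derivable1_diffP; have [] := dF _ x0.
  rewrite (continuous_FTC2 (F := F)) ?EFinB//.
  - apply: continuous_in_subspaceT => x /[!inE]/=; rewrite in_itv/= => /andP[x0 _].
    by apply: cf; rewrite (lt_le_trans e0).
  - split.
    + move=> x; rewrite in_itv/= => /andP[x0 _].
      by have [] := dF _ (lt_trans e0 x0).
    + by apply: cvg_at_right_filter; exact: cF.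
    + by apply: cvg_at_left_filter; exact: cF.
  - move=> x; rewrite in_itv/= => /andP[x0 _].
    by rewrite derive1E; have [_ ->] := dF _ (lt_trans e0 x0).
rewrite -Eunion.
have h : (\int[mu]_(x in E k) (f x)%:E @[k --> \oo]
    --> \int[mu]_(x in \bigcup_k E k) (f x)%:E)%E.
  apply: ge0_nondecreasing_set_cvg_integral => //.
  - apply/nondecreasing_seqP => k; apply/subsetPset => x; rewrite /E/= !in_itv/=.
    by move=> /andP[kx ->]; rewrite andbT (le_trans _ kx)// ler_expR lerN2 ler_nat.
  - by move=> k; exact: measurable_itv.
  - by move=> k; apply/measurable_EFinP; apply: measurable_funS mf => //; exact: EI.
  - by move=> k x /EI; rewrite /= in_itv/= lee_fin => x01; exact: f0.
suff h0 : (\int[mu]_(x in E k) (f x)%:E @[k --> \oo] --> (F 1 - l)%:E)%E.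
  exact: (cvg_unique _ h h0).
rewrite (funext intE).
apply: cvg_EFin; first exact: nearW.
by apply: cvgB => //; exact: cvg_cst.
Qed.

Lemma cvg_expRN_nat (u : nat -> R) : (forall k, `|u k| <= k.+1%:R * expR (- k%:R)) ->
  u @ \oo --> (0 : R).
Proof.
move=> hu.
have h4 : (fun k => 4 * harmonic k) @ \oo --> (0 : R).
  by rewrite -[X in _ --> X](mulr0 4); apply: cvgM; [exact: cvg_cst|exact: cvg_harmonic].
have hN4 : (fun k => - (4 * harmonic k)) @ \oo --> (0 : R).
  by rewrite -[X in _ --> X]oppr0; exact: cvgN.
apply: (squeeze_cvgr _ hN4 h4); apply: nearW => k.
rewrite -ler_norml (le_trans (hu k))// expRN ler_pdivrMr ?expR_gt0//.
rewrite /harmonic/= mulrAC ler_pdivlMr//.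
have k0 : 0 <= k%:R :> R by [].
(* Squaring exp(k/2) >= 1 + k/2 gives a quadratic lower bound, enough to beat the factor k + 1. *)
have : (1 + k%:R / 2) ^+ 2 <= expR k%:R :> R.
  rewrite [in leRHS](splitr k%:R) expRD -expr2 lerXn2r ?nnegrE ?expR_ge0 ?expR_ge1Dx//.
rewrite -[k.+1%:R]natr1; move: (k%:R) k0 (expR _) => a a0 b; rewrite expr2.
by nra.
Qed.

Lemma expR_powN_le1 (m k : nat) : expR (- k%:R) ^+ m <= 1 :> R.
Proof. by rewrite exprn_ile1 ?expR_ge0// -expR0 ler_expR oppr_le0. Qed.

Lemma is_derive_exprS (m : nat) (x : R) :
  is_derive x 1 (fun y : R => y ^+ m.+1) (m.+1%:R * x ^+ m).
Proof.
have -> : (fun y : R => y ^+ m.+1) = horner 'X^(m.+1).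
  by apply/funext => y; rewrite hornerXn.
by apply: is_derive_eq; rewrite derivXn hornerMn hornerXn mulr_natl.
Qed.

Lemma integral_unit_itv_expr (m : nat) :
  (\int[mu]_(x in `]0%R, 1%R[) (x ^+ m)%:E = (m.+1%:R^-1)%:E)%E.
Proof.
have m0 : m.+1%:R != 0 :> R by [].
have -> : m.+1%:R^-1 = m.+1%:R^-1 * 1 ^+ m.+1 - 0 :> R by rewrite expr1n mulr1 subr0.
apply: (@integral_unit_itv (fun x => x ^+ m) (fun x => m.+1%:R^-1 * x ^+ m.+1)).
- move=> x x0; apply: (is_derive_eq (is_deriveZ m.+1%:R^-1 (is_derive_exprS m x))).
  by rewrite /GRing.scale/= mulrA mulVf// mul1r.
- by move=> x _; exact: exprn_continuous.
- by move=> x /andP[x0 _]; rewrite exprn_ge0// ltW.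
apply: cvg_expRN_nat => k; rewrite ger0_norm ?mulr_ge0 ?invr_ge0 ?exprn_ge0 ?expR_ge0//.
rewrite exprS mulrA mulrAC ler_wpM2r ?expR_ge0// (@le_trans _ _ 1)//; last by rewrite ler1n.
by rewrite mulr_ile1 ?invr_ge0 ?exprn_ge0 ?expR_ge0 ?expR_powN_le1// invf_le1// ler1n.
Qed.

Lemma integral_unit_itv_expr_ln (m : nat) :
  (\int[mu]_(x in `]0%R, 1%R[) (x ^+ m * - ln x)%:E = ((m.+1%:R ^+ 2)^-1)%:E)%E.
Proof.
have m0 : m.+1%:R != 0 :> R by [].
(* The antiderivative found by parts, evaluated at 1, minus its limit 0 at the origin. *)
have -> : (m.+1%:R ^+ 2)^-1 = (m.+1%:R ^+ 2)^-1 * 1 ^+ m.+1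
    - m.+1%:R^-1 * (1 ^+ m.+1 * ln 1) - 0 :> R.
  by rewrite expr1n ln1 mulr1 !mulr0 !subr0.
apply: (@integral_unit_itv (fun x => x ^+ m * - ln x)
  (fun x => (m.+1%:R ^+ 2)^-1 * x ^+ m.+1 - m.+1%:R^-1 * (x ^+ m.+1 * ln x))).
- move=> x x0; have dX := is_derive_exprS m x.
  apply: (is_derive_eq (is_deriveB (is_deriveZ (m.+1%:R ^+ 2)^-1 dX)
    (is_deriveZ m.+1%:R^-1 (is_deriveM dX (is_derive1_ln x0))))).
  rewrite /GRing.scale/= (exprS x); move: (m.+1%:R) (x ^+ m) m0 => a b a0.
  by field; rewrite a0 gt_eqF.
- move=> x x0; apply: continuousM; first exact: exprn_continuous.
  by apply: continuousN; exact: continuous_ln.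
- by move=> x /andP[x0 x1]; rewrite mulr_ge0 ?oppr_ge0 ?ln_le0// exprn_ge0// ltW.
apply: cvg_expRN_nat => k; rewrite expRK (exprS (expR _)).
have -> : (m.+1%:R ^+ 2)^-1 * (expR (- k%:R) * expR (- k%:R) ^+ m) -
   m.+1%:R^-1 * (expR (- k%:R) * expR (- k%:R) ^+ m * - k%:R) =
  ((m.+1%:R ^- 2 + m.+1%:R^-1 * k%:R) * expR (- k%:R) ^+ m) * expR (- k%:R) :> R by ring.
rewrite ger0_norm; last first.
  by rewrite !mulr_ge0 ?addr_ge0 ?mulr_ge0 ?invr_ge0 ?exprn_ge0 ?expR_ge0.
rewrite ler_wpM2r ?expR_ge0//.
rewrite -[leRHS]mulr1 ler_pM ?expR_powN_le1 ?exprn_ge0 ?expR_ge0//.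
rewrite -[k.+1%:R]nat1r lerD//.
  by rewrite invf_le1 ?exprn_gt0// exprn_ege1// ler1n.
by rewrite ler_piMl// invf_le1// ler1n.
Qed.
End UnitInterval.

(** * Coefficients of the shifted Legendre polynomials *)

Section Legendre.
Variable R : realType.

Lemma derive1n_horner (p : {poly R}) n : derive1n n (horner p) = horner p^`(n).
Proof. by elim: n => [//|n IH]; rewrite derive1nS IH derivnS derivE. Qed.

Lemma coef_onem_polyX n i : ((1 - 'X : {poly R}) ^+ n)`_i = (-1) ^+ i * 'C(n, i)%:R.
Proof.
rewrite exprDn (eq_bigr (fun k : 'I_n.+1 => ((-1) ^+ k * 'C(n, k)%:R)%:P * 'X^k)).
  rewrite coef_sum (eq_bigr (fun k : 'I_n.+1 =>
    (if (k == i :> nat) then (-1) ^+ i * 'C(n, i)%:R else 0))).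
    case: (ltnP i n.+1) => ni.
      by rewrite (bigD1 (Ordinal ni))//= eqxx big1 ?addr0// => k /negPf; rewrite -val_eqE/= => ->.
    rewrite big1 ?bin_small ?mulr0// => k _.
    by rewrite ltn_eqF// (leq_trans (ltn_ord k)).
  by move=> k _; rewrite coefCM coefXn eq_sym; case: eqP => [->|]; rewrite ?mulr1 ?mulr0.
move=> k _; rewrite expr1n mul1r (exprNn 'X) -mulr_natr polyCM polyC_natr polyC_exp polyCN.
by rewrite -!mulrA (mulrC 'X^k).
Qed.

(** The coefficient of x^(n+j) in x^n (1-x)^n is (-1)^j C(n,j), and the n-th derivative divided by
    n! multiplies it by C(n+j,n). The sign in front offsets the (-1)^n built into [legc]. *)
Lemma shifted_legendreE n (x : R) :
  shifted_legendre n x = (-1) ^+ n * \sum_(j < n.+1) legc R n j * x ^+ j.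
Proof.
rewrite /shifted_legendre.
have -> : (fun t : R => t ^+ n * (1 - t) ^+ n) = horner ('X^n * (1 - 'X) ^+ n).
  by apply/funext => t; rewrite !hornerE.
rewrite derive1n_horner nderivn_def hornerMn -[X in _ * X]mulr_natl mulrA mulVf; last first.
  by rewrite pnatr_eq0 -lt0n fact_gt0.
rewrite mul1r (@horner_coef_wide _ n.+1); last first.
  apply/leq_sizeP => j nj.
  rewrite coef_nderivn coefXnM ltnNge leq_addr/= addKn coef_onem_polyX.
  by rewrite bin_small// mulr0 mul0rn.
rewrite mulr_sumr; apply: eq_bigr => j _.
rewrite mulrA coef_nderivn coefXnM ltnNge leq_addr/= addKn.
have e : 'C(n + j, n) = 'C(n + j, j) by rewrite -(bin_sub (leq_addl n j)) addnK.
rewrite coef_onem_polyX /legc e !mulrA -exprD addnA addnn.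
by rewrite [in RHS]exprD -mul2n exprM sqrrN !expr1n mul1r !mulr_natr.
Qed.
End Legendre.

(** * The integral as a series *)

Section UnitSquare.
Variable R : realType.
Notation mu := (@lebesgue_measure R).
Notation mu2 := ((@lebesgue_measure R) \x (@lebesgue_measure R))%E.
Notation I01 := (`]0%R, 1%R[%classic : set R).

Lemma integral_unit_square_prod (f g : R -> R) :
  measurable_fun I01 f -> measurable_fun I01 g ->
  (forall x, I01 x -> 0 <= f x) -> (forall x, I01 x -> 0 <= g x) ->
  (\int[mu2]_(z in @unit_square R) (f z.1 * g z.2)%:E =
   (\int[mu]_(x in I01) (f x)%:E) * (\int[mu]_(x in I01) (g x)%:E))%E.
Proof.
move=> mf mg f0 g0.
(* Extension by zero moves the integral to the whole plane, where Tonelli applies. *)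
pose f' := ((fun x => (f x)%:E) \_ I01)%E; pose g' := ((fun x => (g x)%:E) \_ I01)%E.
have mI : measurable I01 by exact: measurable_itv.
have mf' : measurable_fun setT f' by apply: (measurable_restrictT _ mI).1; exact/measurable_EFinP.
have mg' : measurable_fun setT g' by apply: (measurable_restrictT _ mI).1; exact/measurable_EFinP.
have f'0 x : (0 <= f' x)%E by apply: erestrict_ge0 => y Dy; rewrite lee_fin f0.
have g'0 x : (0 <= g' x)%E by apply: erestrict_ge0 => y Dy; rewrite lee_fin g0.
rewrite integral_mkcond [X in (_ = X * _)%E]integral_mkcond
  [X in (_ = _ * X)%E]integral_mkcond -/f' -/g'.
transitivity (\int[mu2]_z (f' z.1 * g' z.2))%E.
  apply: eq_integral => -[x y] _; rewrite /f' /g' !patchE /unit_square in_setX/=.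
  by case: (x \in I01); case: (y \in I01); rewrite ?mul0e ?mule0 ?EFinM.
rewrite fubini_tonelli1/=; last 2 first.
- apply: emeasurable_funM; apply: measurableT_comp => //.
- by move=> z; rewrite mule_ge0.
rewrite /fubini_F/=.
under eq_integral => x _ do rewrite ge0_integralZl//.
by rewrite ge0_integralZr// integral_ge0.
Qed.

(** The integrand of [frakJ] with monomials in place of the polynomials; unlike the original it is
    nonnegative on the square. *)
Definition beukers_fun i j (z : R * R) : R :=
  z.1 ^+ i * z.2 ^+ j * (- ln (z.1 * z.2) / (1 - z.1 * z.2)).

(** A term of the geometric expansion, with ln(xy) split as ln x + ln y so that each half separates
    the variables. *)
Definition beukers_summand i j k (z : R * R) : R :=
  z.1 ^+ (i + k) * - ln z.1 * z.2 ^+ (j + k) + z.1 ^+ (i + k) * (z.2 ^+ (j + k) * - ln z.2).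

Definition beukers_term i j k : R :=
  ((i + k).+1%:R ^+ 2)^-1 * (j + k).+1%:R^-1 + (i + k).+1%:R^-1 * ((j + k).+1%:R ^+ 2)^-1.

Lemma measurable_unit_square : measurable (@unit_square R).
Proof. by apply: measurableX; exact: measurable_itv. Qed.

Lemma ln_monomial_ge0 (i j : nat) (z : R * R) : @unit_square R z ->
  0 <= z.1 ^+ i * - ln z.1 * z.2 ^+ j /\ 0 <= z.1 ^+ i * (z.2 ^+ j * - ln z.2).
Proof.
case: z => x y [] /=; rewrite !in_itv/= => /andP[x0 x1] /andP[y0 y1].
by split; rewrite ?mulr_ge0 ?exprn_ge0 ?oppr_ge0 ?ln_le0// ltW.
Qed.

Lemma measurable_ln_monomial (i j : nat) :
  measurable_fun (@unit_square R) (fun z : R * R => z.1 ^+ i * - ln z.1 * z.2 ^+ j) /\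
  measurable_fun (@unit_square R) (fun z : R * R => z.1 ^+ i * (z.2 ^+ j * - ln z.2)).
Proof.
have m1 : measurable_fun setT (fun z : R * R => z.1 ^+ i).
  by apply: measurable_funX; exact: measurable_fst.
have m2 : measurable_fun setT (fun z : R * R => z.2 ^+ j).
  by apply: measurable_funX; exact: measurable_snd.
have l1 : measurable_fun setT (fun z : R * R => - ln z.1).
  by apply: measurableT_comp => //; apply: measurableT_comp => //; exact: measurable_ln.
have l2 : measurable_fun setT (fun z : R * R => - ln z.2).
  by apply: measurableT_comp => //; apply: measurableT_comp => //; exact: measurable_ln.
by split; apply: measurable_funTS; repeat (apply: measurable_funM => //).
Qed.

Lemma beukers_summand_ge0 i j k z : @unit_square R z -> 0 <= beukers_summand i j k z.
Proof. by move=> /(ln_monomial_ge0 (i + k) (j + k))[? ?]; rewrite addr_ge0. Qed.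

Lemma measurable_beukers_summand i j k :
  measurable_fun (@unit_square R) (beukers_summand i j k).
Proof. by have [m1 m2] := measurable_ln_monomial (i + k) (j + k); exact: measurable_funD. Qed.

Lemma integral_beukers_summand i j k :
  (\int[mu2]_(z in @unit_square R) (beukers_summand i j k z)%:E
   = (beukers_term i j k)%:E)%E.
Proof.
have mX n : measurable_fun I01 (fun x : R => x ^+ n).
  by apply: measurable_funTS; exact: measurable_funX.
have ml n : measurable_fun I01 (fun x : R => x ^+ n * - ln x).
  apply: measurable_funM => //; apply: measurable_funTS.
  by apply: measurableT_comp => //; exact: measurable_ln.
have X0 n x : I01 x -> 0 <= x ^+ n.
  by rewrite /= in_itv/= => /andP[x0 _]; rewrite exprn_ge0// ltW.
have l0 n x : I01 x -> 0 <= x ^+ n * - ln x.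
  move=> Ix; rewrite mulr_ge0 ?X0// oppr_ge0 ln_le0//.
  by move: Ix; rewrite /= in_itv/= => /andP[_ /ltW].
have e1 := integral_unit_square_prod (ml (i + k)%N) (mX (j + k)%N) (@l0 _) (@X0 _).
have e2 := integral_unit_square_prod (mX (i + k)%N) (ml (j + k)%N) (@X0 _) (@l0 _).
rewrite /beukers_summand /beukers_term.
under eq_integral do rewrite EFinD.
have [m1 m2] := measurable_ln_monomial (i + k) (j + k).
rewrite ge0_integralD ?e1 ?e2 ?integral_unit_itv_expr ?integral_unit_itv_expr_ln//.
- exact: measurable_unit_square.
- by move=> z /(ln_monomial_ge0 (i + k) (j + k))[].
- exact/measurable_EFinP.
- by move=> z /(ln_monomial_ge0 (i + k) (j + k))[].
- exact/measurable_EFinP.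
Qed.

Lemma beukers_fun_series i j z : @unit_square R z ->
  (\sum_(0 <= k <oo) (beukers_summand i j k z)%:E = (beukers_fun i j z)%:E)%E.
Proof.
case: z => x y [] /=; rewrite !in_itv/= => /andP[x0 x1] /andP[y0 y1].
have xy0 : 0 < x * y by rewrite mulr_gt0.
have xy1 : `|x * y| < 1 by rewrite gtr0_norm// mulr_ilt1 ?ltW.
have h := @cvg_geometric_series R (x ^+ i * y ^+ j * - ln (x * y)) _ xy1.
apply/cvg_lim => //.
rewrite (_ : (fun n => _) = EFin \o series (geometric (x ^+ i * y ^+ j * - ln (x * y)) (x * y))).
  apply: cvg_EFin; first exact: nearW.
  by rewrite /beukers_fun/= mulrA.
apply/funext => K /=; rewrite /series/= -sumEFin; apply: eq_bigr => k _; congr (_%:E).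
by rewrite /beukers_summand/= lnM ?posrE// exprMn !exprD; ring.
Qed.

Lemma beukers_term_cvg i j : cvgn (fun K => \sum_(0 <= k < K) beukers_term i j k).
Proof.
apply: nondecreasing_is_cvgn.
  apply/nondecreasing_seqP => K; rewrite big_nat_recr//= lerDl.
  by rewrite addr_ge0 ?mulr_ge0 ?invr_ge0 ?exprn_ge0.
exists 4 => _ [K _ <-].
rewrite (@le_trans _ _ (2 * \sum_(0 <= k < K) (k.+1%:R ^+ 3)^-1))//; last first.
  rewrite (_ : 4 = 2 * 2 :> R); last by rewrite -natrM.
  by rewrite ler_wpM2l//; have := sum_inv_cube_le R K.+1; rewrite big_add1.
rewrite mulr_sumr; apply: ler_sum => k _.
(* Dropping [i] and [j] only enlarges a term, to 2/(k+1)^3. *)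
have le_inv n : (n + k).+1%:R^-1 <= k.+1%:R^-1 :> R.
  by rewrite lef_pV2 ?posrE// ler_nat ltnS leq_addl.
have -> : 2 * (k.+1%:R ^+ 3)^-1 = k.+1%:R^-1 ^+ 2 * k.+1%:R^-1 + k.+1%:R^-1 * k.+1%:R^-1 ^+ 2 :> R.
  by rewrite -exprVn; ring.
rewrite /beukers_term -!exprVn.
by rewrite lerD// ler_pM ?exprn_ge0 ?invr_ge0// lerXn2r ?nnegrE ?invr_ge0.
Qed.

Lemma integral_beukers_fun i j :
  (\int[mu2]_(z in @unit_square R) (beukers_fun i j z)%:E =
   (limn (fun K => \sum_(0 <= k < K) beukers_term i j k))%:E)%E.
Proof.
transitivity (\int[mu2]_(z in @unit_square R)
    \sum_(0 <= k <oo) (beukers_summand i j k z)%:E)%E.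
  by apply: eq_integral => z; rewrite inE => /beukers_fun_series ->.
rewrite integral_nneseries//; last 3 first.
- exact: measurable_unit_square.
- by move=> k; apply/measurable_EFinP; exact: measurable_beukers_summand.
- by move=> k z Dz; rewrite lee_fin beukers_summand_ge0.
under eq_eseriesr do rewrite integral_beukers_summand.
apply/cvg_lim => //.
rewrite (_ : (fun n => _) = EFin \o (fun K => \sum_(0 <= k < K) beukers_term i j k)).
  apply: cvg_EFin; first exact: nearW.
  exact: beukers_term_cvg.
by apply/funext => K /=; rewrite -sumEFin.
Qed.

(** Nonnegativity and the finite value of the integral suffice. Integrability permits linear
    combinations with the signed coefficients [legc]. *)
Lemma integrable_beukers_fun i j :
  mu2.-integrable (@unit_square R) (fun z => (beukers_fun i j z)%:E).
Proof.
apply/integrableP; split.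
  apply: (@eq_measurable_fun _ _ _ _ _
      (fun z => \sum_(0 <= k <oo) (beukers_summand i j k z)%:E)%E).
    by move=> z; rewrite inE => /beukers_fun_series ->.
  apply: ge0_emeasurable_sum => //.
    by move=> k z Dz _; rewrite lee_fin beukers_summand_ge0.
  by move=> k _; apply/measurable_EFinP; exact: measurable_beukers_summand.
have -> : (\int[mu2]_(z in @unit_square R) `|(beukers_fun i j z)%:E| =
    \int[mu2]_(z in @unit_square R) (beukers_fun i j z)%:E)%E.
  apply: eq_integral => z; rewrite inE => Dz.
  rewrite gee0_abs// -(beukers_fun_series i j Dz).
  by apply: nneseries_ge0 => k _ _; rewrite lee_fin beukers_summand_ge0.
by rewrite integral_beukers_fun ltry.
Qed.

(** Expanding both polynomials makes the integral a finite double sum of limits of [beukers_term]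
    series. Partial fractions at t = k + 1 expand [legterm] into the same double sum, term by term
    in k. *)
Lemma frakJ_cvg n : \sum_(0 <= k < K) legterm R n k @[K --> \oo] --> frakJ R n.
Proof.
pose c (p : 'I_n.+1 * 'I_n.+1) := legc R n p.1 * legc R n p.2.
have -> : frakJ R n = \sum_p c p * limn (fun K => \sum_(0 <= k < K) beukers_term p.1 p.2 k).
  rewrite /frakJ /Rintegral.
  transitivity (fine (\int[mu2]_(z in @unit_square R)
      \sum_p (c p)%:E * (beukers_fun p.1 p.2 z)%:E)%E); last first.
    rewrite integral_sum//=; last 2 first.
    - exact: measurable_unit_square.
    - by move=> p; apply: integrableZl;
      [exact: measurable_unit_square|exact: integrable_beukers_fun].
    rewrite (eq_bigr (fun p =>
      (c p * limn (fun K => \sum_(0 <= k < K) beukers_term p.1 p.2 k))%:E)).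
      by rewrite sumEFin.
    move=> p _; rewrite integralZl//; last 2 first.
    - exact: measurable_unit_square.
    - exact: integrable_beukers_fun.
    by rewrite integral_beukers_fun.
  congr fine; apply: eq_integral => z _.
  rewrite -[RHS]/(\sum_p (c p * beukers_fun p.1 p.2 z)%:E)%E sumEFin; congr (_%:E).
  rewrite !shifted_legendreE.
  rewrite -(pair_bigA _ (fun i j : 'I_n.+1 => legc R n i * legc R n j * beukers_fun i j z))/=.
  have -> : \sum_(i < n.+1) \sum_(j < n.+1) legc R n i * legc R n j * beukers_fun i j z =
      (\sum_(i < n.+1) legc R n i * z.1 ^+ i) * (\sum_(j < n.+1) legc R n j * z.2 ^+ j)
      * (- ln (z.1 * z.2) / (1 - z.1 * z.2)).
    rewrite big_distrlr/= mulr_suml; apply: eq_bigr => i _.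
    rewrite mulr_suml; apply: eq_bigr => j _.
    by rewrite /beukers_fun; ring.
  (* The signs (-1)^n of the two Legendre polynomials cancel. *)
  have s2 : (-1) ^+ n * (-1) ^+ n = 1 :> R by rewrite -expr2 sqrr_sign.
  set a := \sum_(i < n.+1) _; set b := \sum_(i < n.+1) _; set d := 1 - _.
  transitivity ((-1) ^+ n * (-1) ^+ n * (a * b * (- ln (z.1 * z.2) / d))); first by ring.
  by rewrite s2 mul1r.
have -> : (fun K => \sum_(0 <= k < K) legterm R n k)
    = fun K => \sum_p c p * \sum_(0 <= k < K) beukers_term p.1 p.2 k.
  apply/funext => K; rewrite (eq_bigr (fun p => \sum_(0 <= k < K) c p * beukers_term p.1 p.2 k)).
    rewrite exchange_big/=; apply: eq_bigr => k _.
    have [|q dq] := @legq_partial_fractions R n k.+1%:R.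
      by move=> j _; rewrite -natrD pnatr_eq0.
    rewrite /legterm q dq.
    rewrite -(pair_bigA _ (fun i j : 'I_n.+1 => legc R n i * legc R n j * beukers_term i j k))/=.
    have nE (j : nat) : (j + k).+1%:R = k.+1%:R + j%:R :> R by rewrite -natrD addnC addSn.
    under [RHS]eq_bigr do under eq_bigr do rewrite /beukers_term mulrDr mulrACA [X in _ + X]mulrACA.
    under [RHS]eq_bigr do rewrite big_split/=.
    rewrite big_split/= -!big_distrlr/=.
    have -> : \sum_(j < n.+1) legc R n j / (j + k).+1%:R
        = \sum_(j < n.+1) legc R n j / (k.+1%:R + j%:R).
      by apply: eq_bigr => j _; rewrite nE.
    have -> : \sum_(j < n.+1) legc R n j / (j + k).+1%:R ^+ 2
        = \sum_(j < n.+1) legc R n j / (k.+1%:R + j%:R) ^+ 2.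
      by apply: eq_bigr => j _; rewrite nE.
    by ring.
  by move=> p _; rewrite mulr_sumr.
apply: cvg_big => [|p _]; first exact: add_continuous.
by apply: cvgM; [exact: cvg_cst|exact: beukers_term_cvg].
Qed.

Lemma legterm0 k : legterm R 0 k = 2 * (k.+1%:R ^+ 3)^-1.
Proof.
have : k.+1%:R != 0 :> R by [].
by rewrite /legterm /=; move: (k.+1%:R) => a a0; field.
Qed.

Lemma frakJ0 : frakJ R 0 = 2 * zeta3 R.
Proof.
pose u K : R := \sum_(1 <= m < K) (m%:R ^+ 3)^-1.
(* The sum in [zeta3] over 1 <= m < K + 1 has K terms, hence the shift by one; [legq 0] is 1/t, so
   each series term is 2/t^3. *)
have e K : u K.+1 = 2^-1 * \sum_(0 <= k < K) legterm R 0 k.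
  rewrite /u big_add1 mulr_sumr; apply: eq_bigr => k _.
  by rewrite legterm0 mulrA mulVf// mul1r.
have h : u K @[K --> \oo] --> 2^-1 * frakJ R 0.
  rewrite -cvg_shiftS (funext e).
  by apply: cvgM; [exact: cvg_cst|exact: frakJ_cvg].
by rewrite /zeta3 (cvg_lim _ h)// mulrA divff// mul1r.
Qed.

(** Removes the absolute value around [frakJ R 0] left by [apery_geometric]. *)
Lemma frakJ0_ge0 : 0 <= frakJ R 0.
Proof.
apply: (cvgr_to_ge (@frakJ_cvg 0)); apply: nearW => K.
by rewrite sumr_ge0// => k _; rewrite legterm0 mulr_ge0 ?invr_ge0 ?exprn_ge0.
Qed.
End UnitSquare.

Theorem theorem5p14 (R : realType) (n : nat) :
  frakJ R n <= 2 * (1 / 24) ^+ n * zeta3 R.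
Proof.
rewrite (le_trans (ler_norm _))// (le_trans (apery_geometric (@frakJ_cvg R) n))//.
by rewrite ger0_norm ?frakJ0_ge0// frakJ0 mulrAC mul1r exprVn.
Qed.
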